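(* Let $t$ be a positive integer. For all large enough $n$ and $T\geq t$, there exists a positive integer $z_2=z_2(n,t)=\mathcal{O}(n^{2-\frac{1}{t}})$ such that any coloring $E(K_{n,n})=R\sqcup B$ with at least $z_2(n,t)$ edges in each color class contains a colored copy of $K_{T,t+T}$ where one color forms a graph isomorphic to $K_{T,T}$, or a copy of $K_{t,2T}$ where one color forms a graph isomorphic to $K_{t,T}$.
   Context: $K_{a,b}$ denotes the complete bipartite graph with parts of sizes $a$ and $b$. A coloring $E(K_{n,n})=R\sqcup B$ is a $2$-edge coloring, i.e. a partition of the edge set of $K_{n,n}$ into the color classes $R$ (red edges) and $B$ (blue edges). A colored copy of a graph is a subgraph of $K_{n,n}$ isomorphic to that graph, with the inherited edge colors; ''one color forms a graph isomorphic to $H$'' means that, for one of the two colors, the edges of the copy having that color form a graph isomorphic to $H$.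
   Formalization: The bound z_2 and the constant in O(n^{2-1/t}) may depend on T as well as on n and t; a bound independent of T is false (t = 1: a (T-1)-regular red graph contains neither pattern). *)

(* Defs.v *)
From mathcomp Require Import all_boot.

Set Implicit Arguments.
Unset Strict Implicit.
Unset Printing Implicit Defensive.

Record sgraph := SGraph {
  svertex :> finType;
  sedge : rel svertex;
  sedge_sym : symmetric sedge;
  sedge_irrefl : irreflexive sedge }.

Definition edges (G : sgraph) : {set {set G}} :=
  [set [set p.1; p.2] | p : G * G & sedge p.1 p.2].

Section CompleteBipartite.
Variables a b : nat.

Definition Kbip_rel : rel ('I_a + 'I_b) := fun u v =>
  match u, v with
  | inl _, inr _ | inr _, inl _ => true
  | _, _ => false
  end.

Lemma Kbip_rel_sym : symmetric Kbip_rel.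
Proof. by move=> [?|?] [?|?]. Qed.

Lemma Kbip_rel_irrefl : irreflexive Kbip_rel.
Proof. by move=> [?|?]. Qed.

Definition Kbip : sgraph := SGraph Kbip_rel_sym Kbip_rel_irrefl.

End CompleteBipartite.

Section ColoredCopies.
Variable G : sgraph.
Implicit Types (V : {set G}) (F Red Blue : {set {set G}}) (K H : sgraph).

(* A subgraph of G is given by its vertex set V and its edge set F. *)
Definition is_subgraph V F : bool :=
  (F \subset edges G) && (cover F \subset V).

Definition subgraph_iso V F H : Prop :=
  exists f : H -> G,
    [/\ injective f, f @: [set: H] = V
      & forall x y : H, sedge x y = ([set f x; f y] \in F)].

Definition is_copy V F K : Prop := is_subgraph V F /\ subgraph_iso V F K.

Definition is_coloring Red Blue : Prop :=
  Red :|: Blue = edges G /\ [disjoint Red & Blue].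

(* The edges of F of color C, together with the vertices they cover (so that
   vertices incident to no edge of color C are discarded), form a graph
   isomorphic to H. *)
Definition color_forms (C : {set {set G}}) F H : Prop :=
  subgraph_iso (cover (F :&: C)) (F :&: C) H.

Definition has_colored_copy Red Blue K H : Prop :=
  exists V F, is_copy V F K /\ (color_forms Red F H \/ color_forms Blue F H).

End ColoredCopies.

(* Main.v *)
(* Each color has at least n(k + t) edges with 2T n^t <= n k^t, so by the
   Kovari-Sos-Turan double counting each color c has a monochromatic K_{2T,t}
   with 2T vertices X_c on the left and t vertices S_c on the right.  For n at
   least T 2^{4T}, some T right vertices Y see X_Red :|: X_Blue with the same
   color pattern.  If T vertices of X_Blue are red to Y, they span with Y and
   S_Blue a K_{T,t+T} whose red part is K_{T,T}; symmetrically for X_Red.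
   Otherwise T vertices of X_Blue are blue to Y and T vertices of X_Red are red
   to Y, which gives the K_{t,2T} with its t-side in Y.
   Below T 2^{4T}, z2 n exceeds n^2 and the claim is vacuous, so n0 = 0. *)
Require Import Defs.
From HB Require Import structures.
From mathcomp Require Import all_boot all_order all_algebra.
From mathcomp Require Import all_classical all_reals all_analysis.
From mathcomp Require Import zify lra.
Import Order.TTheory GRing.Theory Num.Theory.
Import numFieldNormedType.Exports.

(** * Power means and Kovari-Sos-Turan double counting *)

(** By convexity, [a ^ t.+1] lies above its tangent at [k]; the terms are arranged to avoid
    subtraction. The induction multiplies the previous case by [a] and adds a multiple of
    [2ak <= a^2 + k^2]. *)
Lemma tangent_expn t k a : t.+1 * (k ^ t * a) <= a ^ t.+1 + t * k ^ t.+1.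
Proof.
elim: t => [|t IH]; first by rewrite expn0 !mul1n mul0n addn0 expn1.
have := leq_mul (leqnn a) IH.
have := leq_mul (leqnn (t.+1 * k ^ t)) (nat_Cauchy a k).
rewrite !expnS !expn0 !muln1; move: (a ^ t) (k ^ t) => u v; lia.
Qed.

(** Jensen's inequality without division: sum the tangent inequalities at [k], then bound the linear
    term by the hypothesis on the average. *)
Lemma power_mean (X : finType) (a : X -> nat) (k t : nat) :
  #|X| * k <= \sum_x a x -> #|X| * k ^ t <= \sum_x a x ^ t.
Proof.
case: t => [|t] ge_a; first by rewrite sum1_card muln1.
have sum_tangent : t.+1 * (k ^ t * \sum_x a x) <=
    \sum_x a x ^ t.+1 + #|X| * (t * k ^ t.+1).
  rewrite -sum_nat_const -big_split !big_distrr /=.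
  by apply: leq_sum => x _; apply: tangent_expn.
move: sum_tangent (leq_mul (leqnn (t.+1 * k ^ t)) ge_a); rewrite expnS.
move: (k ^ t) (\sum_x a x) (\sum_x a x ^ _) => u v w; lia.
Qed.

Lemma leq_subn_exp_ffact d t : (d - t) ^ t <= d ^_ t.
Proof.
elim: t d => [|t IH] [|d] //; first by rewrite sub0n exp0n.
by rewrite ffactnS subSS expnS leq_mul //; lia.
Qed.

Lemma leq_ffact_exp n t : n ^_ t <= n ^ t.
Proof.
elim: t n => [|t IH] n //; rewrite ffactnS expnS leq_mul //.
by apply: leq_trans (IH _) _; case: t {IH} => // t; rewrite leq_exp2r ?leq_pred.
Qed.

(** Both sides count the pairs [(x, S)] with [#|S| = t] and [S \subset N x]. *)
Lemma sum_bin_common (X Y : finType) (N : X -> {set Y}) (t : nat) :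
  \sum_x 'C(#|N x|, t) =
  \sum_(S : {set Y} | #|S| == t) #|[set x | S \subset N x]|.
Proof.
under [RHS]eq_bigr => S _.
  rewrite -sum1dep_card big_mkcond /=; over.
rewrite exchange_big /=; apply: eq_bigr => x _.
rewrite -cards_draws -sum1dep_card big_mkcondl big_mkcond [RHS]big_mkcond /=.
by apply: eq_bigr => S _; case: ifP.
Qed.

Lemma kovari_sos_turan (X Y : finType) (N : X -> {set Y}) (M k t : nat) :
  0 < M -> 0 < #|Y| -> #|X| * (k + t) <= \sum_x #|N x| ->
  M * #|Y| ^ t <= #|X| * k ^ t ->
  exists2 S : {set Y}, #|S| = t & M <= #|[set x | S \subset N x]|.
Proof.
move=> M_gt0 Y_gt0 degN leMk.
have [/existsP[S /andP[/eqP St MS]]|/existsPn noS] :=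
  boolP [exists S : {set Y}, (#|S| == t) && (M <= #|[set x | S \subset N x]|)].
  by exists S.
(* If every [t]-set has fewer than [M] common neighbours, the pair count is small; the degrees force
   it to be large. *)
have few : \sum_x 'C(#|N x|, t) <= M.-1 * 'C(#|Y|, t).
  rewrite sum_bin_common -[#|Y|]cardsT -cards_draws mulnC -sum1dep_card.
  rewrite big_distrl /= [leqRHS](eq_bigl (fun S : {set Y} => #|S| == t)).
    apply: leq_sum => S St; have := noS S.
    by rewrite St mul1n -ltnNge => ltM; rewrite -ltnS prednK.
  by move=> S; rewrite finset.subsetT.
(* The extra [t] in the average degree [k + t] pays for the truncated subtraction. *)
have many : #|X| * k ^ t <= \sum_x (#|N x| - t) ^ t.
  apply: power_mean.
  rewrite -(leq_add2r (#|X| * t)) -mulnDr.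
  rewrite -[in leqRHS]sum_nat_const -big_split /=.
  by apply: leq_trans degN _; apply: leq_sum => x _; rewrite addnC -leq_subLR.
(* Multiplying by [t!] turns binomials into falling factorials, which lie between [(d - t) ^ t] and
   [d ^ t]. *)
have : \sum_x (#|N x| - t) ^ t <= M.-1 * #|Y| ^ t.
  apply: (@leq_trans (\sum_x 'C(#|N x|, t) * t`!)).
    by apply: leq_sum => x _; rewrite bin_ffact leq_subn_exp_ffact.
  rewrite -big_distrl /= (leq_trans (leq_mul few (leqnn _))) //.
  by rewrite -mulnA bin_ffact leq_mul2l leq_ffact_exp orbT.
have : 0 < #|Y| ^ t by rewrite expn_gt0 Y_gt0.
nia.
Qed.

(** * Pigeonhole on color patterns *)

(** The patterns lie in the powerset of [W], so their number depends on [W] and not on the ambient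
    type [Z], which grows with [n] in the application. *)
Lemma pigeonhole_fiber (Y Z : finType) (p : Y -> {set Z}) (W : {set Z})
    (T : nat) :
  (forall y, p y \subset W) -> 0 < T -> T * 2 ^ #|W| <= #|Y| ->
  exists P : {set Z}, T <= #|[set y | p y == P]|.
Proof.
move=> pW T_gt0 leY.
have [/existsP//|/existsPn noP] :=
  boolP [exists P : {set Z}, T <= #|[set y | p y == P]|].
suff : #|Y| <= T.-1 * 2 ^ #|W|.
  move=> /(leq_trans leY); rewrite leq_mul2r expn_eq0 /=.
  by rewrite leqNgt prednK ?leqnn.
rewrite -card_powerset mulnC -sum_nat_const -sum1_card.
rewrite (partition_big p (mem (powerset W))) /=; last first.
  by move=> y _; rewrite powersetE.
by apply: leq_sum => P _; rewrite sum1dep_card -ltnS prednK // ltnNge noP.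
Qed.

Lemma subset_of_card (Y : finType) (A : {set Y}) (m : nat) :
  m <= #|A| -> exists2 B : {set Y}, B \subset A & #|B| = m.
Proof.
rewrite -bin_gt0 -cards_draws card_gt0 => /set0Pn[B].
by rewrite inE => /andP[? /eqP ?]; exists B.
Qed.

(** * Complete bipartite subgraphs and their colored copies *)

Definition joining {V : finType} (A B : {set V}) : {set {set V}} :=
  [set [set x; y] | x in A, y in B].

Lemma set2_inj (V : finType) (x y u v : V) :
  [set x; y] = [set u; v] -> x = u /\ y = v \/ x = v /\ y = u.
Proof.
move=> E; have := set22 u v; have := set21 u v; rewrite -E !inE.
have := set22 x y; have := set21 x y; rewrite E !inE.
by do 4![case/orP=> /eqP ?]; subst; auto.
Qed.

Lemma joiningP (V : finType) (A B : {set V}) (x y : V) :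
  [set x; y] \in joining A B -> x \in A /\ y \in B \/ x \in B /\ y \in A.
Proof.
by case/imset2P => u v uA vB /set2_inj[] [-> ->]; [left | right].
Qed.

(** Each vertex needs a partner on the other side: with one side empty there would be no edges and
    nothing covered. *)
Lemma cover_joining (V : finType) (A B : {set V}) :
  0 < #|A| -> 0 < #|B| -> finset.cover (joining A B) = A :|: B.
Proof.
move=> /card_gt0P[a aA] /card_gt0P[b bB]; apply/setP => z; rewrite inE.
apply/bigcupP/orP => [[e /imset2P[x y xA yB ->]]|[zA|zB]].
- by rewrite !inE => /orP[] /eqP ->; [left | right].
- by exists [set z; b]; [apply: imset2_f | apply: set21].
- by exists [set a; z]; [apply: imset2_f | apply: set22].
Qed.

Lemma subgraph_iso_joining (G : sgraph) (A B : {set G}) (a b : nat) :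
  [disjoint A & B] -> #|A| = a -> #|B| = b ->
  subgraph_iso (A :|: B) (joining A B) (Kbip a b).
Proof.
move=> dAB <- <-.
pose f (u : Kbip #|A| #|B|) : G :=
  match u with inl i => enum_val i | inr j => enum_val j end.
have AB z : z \in A -> z \in B -> False by move=> /(disjointFr dAB) ->.
exists f; split.
- move=> [i|i] [j|j] /= E; first by rewrite (enum_val_inj E).
  + by case: (AB (enum_val i)); rewrite ?enum_valP // E enum_valP.
  + by case: (AB (enum_val j)); rewrite ?enum_valP // -E enum_valP.
  + by rewrite (enum_val_inj E).
- apply/setP => z; apply/imsetP/setUP => [[[i|i] _ ->]|[zA|zB]].
  + by left; apply: enum_valP.
  + by right; apply: enum_valP.
  + by exists (inl (enum_rank_in zA z)); rewrite ?inE //= enum_rankK_in.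
  + by exists (inr (enum_rank_in zB z)); rewrite ?inE //= enum_rankK_in.
- move=> [i|i] [j|j]; apply/esym => /=.
  + apply/negP => /joiningP[[_ jB]|[iB _]].
      exact: AB _ (enum_valP j) jB.
    exact: AB _ (enum_valP i) iB.
  + by apply: imset2_f; apply: enum_valP.
  + by rewrite finset.setUC; apply: imset2_f; apply: enum_valP.
  + apply/negP => /joiningP[[iA _]|[_ jA]].
      exact: AB _ iA (enum_valP i).
    exact: AB _ jA (enum_valP j).
Qed.

Lemma edges_neq (G : sgraph) (x y : G) : [set x; y] \in edges G -> x != y.
Proof.
case/imsetP => [[u v] /= uv /set2_inj H]; rewrite inE /= in uv.
by apply/eqP => xy; move: uv; case: H => [] [<- <-]; rewrite xy sedge_irrefl.
Qed.

(** Common source of both outcomes, with [(a, b, c)] equal to [(T, T, t)] or [(t, T, T)]. The three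
    sets are automatically disjoint, and [C] meets no edge of color [C1], so it drops out of the
    color subgraph. *)
Lemma two_colored_copy (G : sgraph) (C1 C2 : {set {set G}}) (A B C : {set G})
    (a b c : nat) :
  C1 \subset edges G -> C2 \subset edges G -> [disjoint C1 & C2] ->
  0 < a -> 0 < b -> #|A| = a -> #|B| = b -> #|C| = c ->
  {in A & B, forall x y, [set x; y] \in C1} ->
  {in A & C, forall x y, [set x; y] \in C2} ->
  exists V F, is_copy V F (Kbip a (c + b)) /\ color_forms C1 F (Kbip a b).
Proof.
move=> sC1 sC2 dC a_gt0 b_gt0 Aa Bb Cc AB1 AC2.
have dAB : [disjoint A & B].
  apply/pred0P => z /=; apply/negP => /andP[zA zB].
  have := edges_neq _ _ _ (fintype.subsetP sC1 _ (AB1 _ _ zA zB)).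
  by rewrite eqxx.
have dAC : [disjoint A & C].
  apply/pred0P => z /=; apply/negP => /andP[zA zC].
  have := edges_neq _ _ _ (fintype.subsetP sC2 _ (AC2 _ _ zA zC)).
  by rewrite eqxx.
(* A vertex common to [B] and [C] would be joined to [x0] by an edge of both colors. *)
have [x0 x0A] : exists x, x \in A by apply/card_gt0P; rewrite Aa.
have dBC : [disjoint C & B].
  apply/pred0P => z /=; apply/negP => /andP[zC zB].
  by have := disjointFr dC (AB1 _ _ x0A zB); rewrite (AC2 _ _ x0A zC).
exists (A :|: (C :|: B)), (joining A (C :|: B)); split; first split.
- apply/andP; split; last first.
    by rewrite cover_joining ?Aa // cardsU disjoint_setI0 // cards0; lia.
  apply/fintype.subsetP => e /imset2P[x y xA /setUP[yC|yB] ->].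
    exact: (fintype.subsetP sC2 _ (AC2 _ _ xA yC)).
  exact: (fintype.subsetP sC1 _ (AB1 _ _ xA yB)).
- apply: subgraph_iso_joining => //.
    by rewrite -setI_eq0 finset.setIUr !disjoint_setI0 ?finset.setU0.
  by rewrite cardsU disjoint_setI0 // cards0 subn0 Cc Bb.
- rewrite /color_forms; suff -> : joining A (C :|: B) :&: C1 = joining A B.
    rewrite cover_joining ?Aa ?Bb //; exact: subgraph_iso_joining.
  apply/setP => e; rewrite inE; apply/andP/idP.
    case=> /imset2P[x y xA /setUP[yC|yB] ->] eC1; last exact: imset2_f.
    by have := disjointFr dC eC1; rewrite AC2.
  case/imset2P => x y xA yB ->; rewrite AB1 //; split => //.
  by apply: imset2_f; rewrite // inE yB orbT.
Qed.

(** Transfer to index sets: the choice of [f] and [g] among [inl] and [inr] decides on which side of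
    [Kbip n n] the set [A] lies. *)
Lemma two_colored_copy_imset (G : sgraph) (C1 C2 : {set {set G}})
    (I J : finType) (f : I -> G) (g : J -> G) (A : {set I}) (B C : {set J})
    (a b c : nat) :
  C1 \subset edges G -> C2 \subset edges G -> [disjoint C1 & C2] ->
  injective f -> injective g ->
  0 < a -> 0 < b -> #|A| = a -> #|B| = b -> #|C| = c ->
  {in A & B, forall x y, [set f x; g y] \in C1} ->
  {in A & C, forall x y, [set f x; g y] \in C2} ->
  exists V F, is_copy V F (Kbip a (c + b)) /\ color_forms C1 F (Kbip a b).
Proof.
move=> sC1 sC2 dC f_inj g_inj a_gt0 b_gt0 Aa Bb Cc AB1 AC2.
apply: (two_colored_copy _ _ _ (f @: A) (g @: B) (g @: C) _ _ _ sC1 sC2 dC);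
  rewrite ?card_imset //.
- by move=> _ _ /imsetP[x xA ->] /imsetP[y yB ->]; apply: AB1.
- by move=> _ _ /imsetP[x xA ->] /imsetP[y yC ->]; apply: AC2.
Qed.

(** * Two-colorings of the balanced complete bipartite graph *)

Definition cross {n : nat} (x y : 'I_n) : {set Kbip n n} :=
  [set (inl x : Kbip n n); inr y].

Definition nbh {n : nat} (C : {set {set Kbip n n}}) (x : 'I_n) : {set 'I_n} :=
  [set y | cross x y \in C].

(** Every edge in [C] is [cross x y] for some pair, so [C] lies in the image of the incidence
    pairs. *)
Lemma leq_card_sum_nbh (n : nat) (C : {set {set Kbip n n}}) :
  C \subset edges (Kbip n n) -> #|C| <= \sum_x #|nbh C x|.
Proof.
move=> sC; pose D := [set p : 'I_n * 'I_n | p.2 \in nbh C p.1].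
have -> : \sum_x #|nbh C x| = #|D|.
  under eq_bigr do rewrite -sum1_card.
  by rewrite pair_big_dep /= sum1dep_card.
apply: leq_trans (leq_imset_card (fun p => cross p.1 p.2) D).
apply: subset_leq_card; apply/fintype.subsetP => e eC.
have /imsetP[[[x|x] [y|y]]] := fintype.subsetP sC _ eC; rewrite inE //= => _ E.
- by apply/imsetP; exists (x, y); rewrite // !inE /cross -E.
- rewrite finset.setUC in E.
  by apply/imsetP; exists (y, x); rewrite // !inE /cross -E.
Qed.

Lemma leq_card_edges (n : nat) (C : {set {set Kbip n n}}) :
  C \subset edges (Kbip n n) -> #|C| <= n * n.
Proof.
move=> /leq_card_sum_nbh/leq_trans; apply.
rewrite -[X in X * _]card_ord -sum_nat_const leq_sum // => x _.
by rewrite -[leqRHS]card_ord max_card.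
Qed.

Lemma monochromatic_common_nbh (n t M k : nat) (C : {set {set Kbip n n}}) :
  C \subset edges (Kbip n n) -> 0 < n -> 0 < M -> M * n ^ t <= n * k ^ t ->
  n * (k + t) <= #|C| ->
  exists S X : {set 'I_n},
    [/\ #|S| = t, #|X| = M & {in X & S, forall x y, cross x y \in C}].
Proof.
move=> sC n_gt0 M_gt0 leM leC.
have [||||S St] := kovari_sos_turan 'I_n 'I_n (nbh C) M k t;
  rewrite ?card_ord //.
  exact: leq_trans leC (leq_card_sum_nbh _ _ sC).
case/subset_of_card => X /fintype.subsetP sX XM; exists S, X.
split=> // x y xX yS.
by have := sX x xX; rewrite inE => /fintype.subsetP/(_ y yS); rewrite inE.
Qed.

Lemma cross_color (n : nat) (Red Blue : {set {set Kbip n n}}) (x y : 'I_n) :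
  is_coloring Red Blue -> (cross x y \in Blue) = (cross x y \notin Red).
Proof.
move=> [RB dRB]; have : cross x y \in Red :|: Blue.
  by rewrite RB; apply/imsetP; exists (inl x, inr y); rewrite ?inE.
rewrite inE; case: (boolP (cross x y \in Red)) => //= xyR _.
by rewrite (disjointFr dRB xyR).
Qed.

Lemma colored_copy_of_dense (n t T k : nat) (Red Blue : {set {set Kbip n n}}) :
  0 < t -> t <= T -> T * 2 ^ (4 * T) <= n -> 2 * T * n ^ t <= n * k ^ t ->
  is_coloring Red Blue -> n * (k + t) <= #|Red| -> n * (k + t) <= #|Blue| ->
  has_colored_copy Red Blue (Kbip T (t + T)) (Kbip T T) \/
  has_colored_copy Red Blue (Kbip t (2 * T)) (Kbip t T).
Proof.
move=> t_gt0 tT len lek col leR leB; have [RB dRB] := col.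
have T_gt0 := leq_trans t_gt0 tT.
have n_gt0 : 0 < n by apply: leq_trans len; rewrite muln_gt0 T_gt0 expn_gt0.
have sR : Red \subset edges (Kbip n n) by rewrite -RB finset.subsetUl.
have sB : Blue \subset edges (Kbip n n) by rewrite -RB finset.subsetUr.
have dBR : [disjoint Blue & Red] by rewrite disjoint_sym.
have M_gt0 : 0 < 2 * T by rewrite muln_gt0.
have [SR [XR [SRt XRT XRSR]]] :=
  monochromatic_common_nbh _ _ _ _ _ sR n_gt0 M_gt0 lek leR.
have [SB [XB [SBt XBT XBSB]]] :=
  monochromatic_common_nbh _ _ _ _ _ sB n_gt0 M_gt0 lek leB.
have [||P] := pigeonhole_fiber 'I_n 'I_n
    (fun y => [set x in XR :|: XB | cross x y \in Red]) (XR :|: XB) T _ T_gt0.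
- by move=> y; apply/fintype.subsetP => x; rewrite inE => /andP[].
(* The union of two sets of size [2 * T] has at most [4 * T] elements, whence the factor
   [2 ^ (4 * T)]. *)
- rewrite card_ord; apply: leq_trans len; rewrite leq_mul2l leq_exp2l //.
  by rewrite cardsU XRT XBT; apply/orP; right; lia.
case/subset_of_card => Y /fintype.subsetP YP YT.
have PE x y : x \in XR :|: XB -> y \in Y -> (cross x y \in Red) = (x \in P).
  by move=> xX /YP; rewrite inE => /eqP <-; rewrite inE xX.
have XRP x y : x \in XR -> y \in Y -> (cross x y \in Red) = (x \in P).
  by move=> xX; apply: PE; rewrite inE xX.
have XBP x y : x \in XB -> y \in Y -> (cross x y \in Red) = (x \in P).
  by move=> xX; apply: PE; rewrite inE xX orbT.
(* [P] is the common red pattern: on [XR :|: XB], members of [P] are red to all of [Y] and the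
   others blue to all of [Y]. *)
have [leT|ltT] := leqP T #|XB :&: P|.
  have [A /fintype.subsetP sA AT] := subset_of_card _ _ _ leT; left.
  have [||V [F [VF RF]]] := two_colored_copy_imset (Kbip n n) Red Blue 'I_n 'I_n
    inl inr A Y SB T T t sR sB dRB inl_inj inr_inj T_gt0 T_gt0 AT YT SBt.
  - by move=> x y /sA; rewrite inE => /andP[xX xP] yY; rewrite [_ \in _]XBP.
  - by move=> x y /sA; rewrite inE => /andP[xX xP] yY; apply: XBSB.
  by exists V, F; auto.
have [leT|ltT'] := leqP T #|XR :\: P|.
  have [A /fintype.subsetP sA AT] := subset_of_card _ _ _ leT; left.
  have [||V [F [VF RF]]] := two_colored_copy_imset (Kbip n n) Blue Red 'I_n 'I_n
    inl inr A Y SR T T t sB sR dBR inl_inj inr_inj T_gt0 T_gt0 AT YT SRt.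
  - move=> x y /sA; rewrite inE => /andP[xP xX] yY.
    by rewrite [_ \in _](cross_color _ _ _ _ _ col) XRP.
  - by move=> x y /sA; rewrite inE => /andP[xP xX] yY; apply: XRSR.
  by exists V, F; auto.
(* Fewer than [T] of the [2 * T] vertices were of the other kind. *)
have leXR : T <= #|XR :&: P| by have := cardsID P XR; lia.
have leXB : T <= #|XB :\: P| by have := cardsID P XB; lia.
have [B /fintype.subsetP sB' BT] := subset_of_card _ _ _ leXR.
have [C /fintype.subsetP sC CT] := subset_of_card _ _ _ leXB.
have [A /fintype.subsetP sA At] :
    exists2 A : {set 'I_n}, A \subset Y & #|A| = t.
  by apply: subset_of_card; rewrite YT.
(* The side of size [t] now lies on the right, inside [Y], so [inr] and [inl] trade places. *)
have [||V [F [VF RF]]] := two_colored_copy_imset (Kbip n n) Red Blue 'I_n 'I_n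
  inr inl A B C t T T sR sB dRB inr_inj inl_inj t_gt0 T_gt0 At BT CT.
- move=> y x /sA yY /sB'; rewrite inE finset.setUC => /andP[xX xP].
  by rewrite [_ \in _]XRP.
- move=> y x /sA yY /sC; rewrite inE finset.setUC => /andP[xP xX].
  by rewrite [_ \in _](cross_color _ _ _ _ _ col) XBP.
by right; exists V, F; rewrite mul2n -addnn; auto.
Qed.

Local Open Scope classical_set_scope.
Local Open Scope ring_scope.

(** * Real exponents and the order of magnitude of the bound *)

(** Raising to the power [t] gives [k ^ t >= n ^ (t - 1)]; a factor [n] completes it. Adding
    exponents uses a nonzero base, so [n = 0] is separate. *)
Lemma natr_le_powR_inv (R : realType) (n t k : nat) : (0 < t)%N ->
  n%:R `^ (1 - t%:R^-1) <= k%:R :> R -> (n ^ t <= n * k ^ t)%N.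
Proof.
move=> t_gt0 lek; rewrite -(ler_nat R) natrM !natrX.
have t_neq0 : t%:R != 0 :> R by rewrite pnatr_eq0 -lt0n.
have [->|n_neq0] := eqVneq n 0%N; first by rewrite mul0r expr0n gtn_eqF.
have -> : n%:R ^+ t = n%:R * (n%:R `^ (1 - t%:R^-1)) ^+ t :> R.
  rewrite -[in RHS]powR_mulrn ?powR_ge0 // -powRrM -[X in X * _]powRr1 //.
  rewrite -powRD ?pnatr_eq0 ?n_neq0 ?implybT //.
  by rewrite mulrBl mul1r mulVf // addrC subrK powR_mulrn.
by rewrite ler_wpM2l // lerXn2r ?nnegrE ?powR_ge0.
Qed.

(** Write [p] for the power with exponent [1 - 1/t]. Since [p >= 1], the rounded-up value is at most
    [2p] and [t <= t * p], which yields the constant [4 * T + t]. *)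
Lemma edge_bound_le_powR (R : realType) (n t T : nat) :
  (0 < n)%N -> (0 < t)%N ->
  (n * (2 * T * (Num.truncn (n%:R `^ (1 - t%:R^-1) : R)).+1 + t))%:R
    <= (4 * T + t)%:R * n%:R `^ (2 - t%:R^-1) :> R.
Proof.
move=> n_gt0 t_gt0; set p := n%:R `^ (1 - t%:R^-1).
have p_ge1 : 1 <= p.
  rewrite -(powRr0 (n%:R : R)) ler_powR ?ler1n //.
  by rewrite subr_ge0 invf_le1 ?ler1n ?ltr0n.
have le_trunc : (Num.truncn p)%:R <= p by rewrite truncn_le powR_ge0.
have -> : n%:R `^ (2 - t%:R^-1) = n%:R * p :> R.
  rewrite -{2}(powRr1 (ler0n R n)) -powRD; last first.
    by rewrite pnatr_eq0 -lt0n n_gt0 implybT.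
  by congr (_ `^ _); rewrite addrA.
rewrite natrM mulrCA ler_wpM2l // [X in X <= _]natrD [X in X * _]natrD mulrDl.
rewrite lerD ?ler_peMr // !natrM -(natr1 (Num.truncn p)).
have : 0 <= T%:R :> R by [].
nra.
Qed.

(* MathComp world; MathComp-Analysis supplies the Landau notation and powR. *)
Theorem theorem2 (R : realType) (t : nat) (t_gt0 : (0 < t)%N) :
  exists n0 : nat, forall T : nat, (t <= T)%N ->
  exists z2 : nat -> nat,
    (fun n : nat => (z2 n)%:R : R^o)
      =O_\oo (fun n : nat => n%:R `^ (2 - t%:R^-1) : R^o) /\
    forall n : nat, (n0 <= n)%N ->
      (0 < z2 n)%N /\
      forall Red Blue : {set {set Kbip n n}},
        is_coloring Red Blue ->
        (z2 n <= #|Red|)%N -> (z2 n <= #|Blue|)%N ->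
        has_colored_copy Red Blue (Kbip T (t + T)) (Kbip T T) \/
        has_colored_copy Red Blue (Kbip t (2 * T)) (Kbip t T).
Proof.
exists 0%N => T tT.
pose r n := (Num.truncn (n%:R `^ (1 - t%:R^-1) : R)).+1.
pose n1 := (T * 2 ^ (4 * T))%N.
have T_gt0 : (0 < T)%N := leq_trans t_gt0 tT.
have n1_gt0 : (0 < n1)%N by rewrite muln_gt0 T_gt0 expn_gt0.
(* [n0] is fixed before [T], while [n1] depends on [T]; the range below [n1] is therefore absorbed
   into [z2], where finitely many values leave the growth rate intact. *)
exists (fun n =>
  if (n < n1)%N then (n * n).+1%N else (n * (2 * T * r n + t))%N).
split.
  apply/eqO_exP; exists (4 * T + t)%:R.
    by rewrite ltr0n addn_gt0 t_gt0 orbT.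
  near=> n; have le_n1n : (n1 <= n)%N by near: n; exists n1.
  rewrite ltnNge le_n1n /= ger0_norm // ger0_norm ?powR_ge0 //.
  exact: edge_bound_le_powR (leq_trans n1_gt0 le_n1n) t_gt0.
move=> n _ /=; case: (ltnP n n1) => [_|le_n1n].
  split=> // Red Blue [RB _] leR _.
  have sR : Red \subset edges (Kbip n n) by rewrite -RB finset.subsetUl.
  by have := leq_trans leR (leq_card_edges _ _ sR); rewrite ltnn.
have n_gt0 := leq_trans n1_gt0 le_n1n.
split; first by rewrite muln_gt0 n_gt0 addn_gt0 t_gt0 orbT.
move=> Red Blue; apply: colored_copy_of_dense => //.
have le_nr : (n ^ t <= n * r n ^ t)%N.
  by apply: (natr_le_powR_inv R) => //; rewrite ltW ?truncnS_gt.
(* With [k = 2 * T * r n], the factor [2 * T] is covered by [(2 * T) ^ t], as [t] is positive. *)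
rewrite expnMn mulnCA leq_mul // -[leqLHS]expn1 leq_pexp2l //.
by rewrite muln_gt0.
Unshelve. all: by end_near. Qed.
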